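(* Let $H$ be Higman's group, $H=\langle a_i\ (i\in\mathbb Z/4\mathbb Z)\mid a_i a_{i+1} a_i^{-1}=a_{i+1}^2 \text{ for all } i\in \mathbb Z/4\mathbb Z\rangle$. Every homomorphism $\rho:H\to \mathsf{Diff}^1(\mathbb R)$ is trivial. Likewise, every homomorphism $\rho:H\to\mathsf{Diff}^1(\mathbb S^1)$ is trivial.
   Context: $\mathsf{Diff}^1(M)$ denotes the group of $C^1$-diffeomorphisms of the manifold $M$. *)

(* Defs.v *)
From Stdlib Require Import Reals ZArith.
From Coquelicot Require Import Coquelicot.
Open Scope R_scope.

Definition C1 (f : R -> R) : Prop :=
  forall x, ex_derive f x /\ continuous (Derive f) x.

Definition Diff1R (f g : R -> R) : Prop :=
  C1 f /\ C1 g /\ (forall x, g (f x) = x) /\ (forall x, f (g x) = x).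

(* An element of Diff^1(S^1), S^1 = R/Z, is represented by a lift F
   (a C^1-diffeomorphism of R, with inverse G) of degree +1 or -1.
   Two lifts represent the same circle map iff they differ by an integer. *)
Definition CircleDiff1Lift (F G : R -> R) : Prop :=
  Diff1R F G /\
  ((forall x, F (x + 1) = F x + 1) \/ (forall x, F (x + 1) = F x - 1)).

Definition circ_eq (F F' : R -> R) : Prop :=
  exists k : Z, forall x, F x = F' x + IZR k.

Definition higman_rel_R (a ai b : R -> R) : Prop :=
  forall x, a (b (ai x)) = b (b x).

Definition higman_rel_S1 (a ai b : R -> R) : Prop :=
  circ_eq (fun x => a (b (ai x))) (fun x => b (b x)).

(* Main.v *)
(* Suppose [a b a^-1 = b^2] for increasing homeomorphisms of the line, and let
   [(p, q)] be a component of the complement of Fix b (a gap of [b]) whose right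
   end [q <= +oo] is fixed by [a].  Then [a] and [b] act on the gap like
   [x -> 2 x] and [x -> x + 1], so [a] has a gap [(p', q)] with [p < p'].
   Going around the four relations of Higman's group would move [p] strictly to
   the right inside one and the same gap, a contradiction.  For [q = +oo] this
   applies at once, so each Fix a_i is unbounded in both directions.  For finite
   [q] it remains to see that [a q = q]; otherwise the images of [(p, q)] under
   the negative iterates of [a] shrink to a finite fixed point of [a], which a
   C^1 estimate excludes.  On the circle, the lifts can be corrected by integer
   translations so as to satisfy the relations exactly, which reduces the
   problem to the line. *)
Require Import Defs.
From Stdlib Require Import Reals ZArith Lra Lia Classical.
From Coquelicot Require Import Coquelicot.
Open Scope R_scope.

(** * Increasing homeomorphisms, gaps and reflection *)

Definition incr (f : R -> R) : Prop := forall x y, x < y -> f x < f y.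

Definition incr_homeo (f g : R -> R) : Prop :=
  incr f /\ (forall x, g (f x) = x) /\ (forall x, f (g x) = x) /\
  (forall x, continuous f x) /\ (forall x, continuous g x).

(* The Baumslag-Solitar relation [a b a^-1 = b^2]. *)
Definition bs (a b : R -> R) : Prop := forall x, a (b x) = b (b (a x)).

(** Infinite points count as fixed: an increasing homeomorphism of the line extends to the two-point
    compactification and fixes both added points. *)
Definition fixes (f : R -> R) (q : Rbar) : Prop :=
  match q with Finite r => f r = r | _ => True end.

Definition gap (f : R -> R) (p q : Rbar) : Prop :=
  Rbar_lt p q /\ fixes f p /\ fixes f q /\
  forall x : R, Rbar_lt p x -> Rbar_lt x q -> f x <> x.

(** Conjugation by the orientation-reversing map [x -> - x]; it carries results about one end of a
    gap to the other end. *)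
Definition reflect (f : R -> R) (x : R) : R := - f (- x).

Lemma incr_le (f : R -> R) (x y : R) : incr f -> x <= y -> f x <= f y.
Proof.
  intros Hf [H | ->]; [left; now apply Hf | right; reflexivity].
Qed.

Lemma incr_homeo_sym (f g : R -> R) : incr_homeo f g -> incr_homeo g f.
Proof.
  intros (Hf & Hgf & Hfg & Cf & Cg); repeat split; auto.
  intros x y Hxy.
  destruct (Rlt_or_le (g x) (g y)) as [H | H]; auto.
  apply (incr_le f _ _ Hf) in H; rewrite !Hfg in H; lra.
Qed.

Lemma incr_fix_square (f : R -> R) (x : R) : incr f -> f (f x) = x -> f x = x.
Proof.
  intros Hf H.
  destruct (Rtotal_order (f x) x) as [L | [E | L]]; auto;
    generalize (Hf _ _ L); lra.
Qed.

Lemma continuous_reflect (f : R -> R) :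
  (forall x, continuous f x) -> forall x, continuous (reflect f) x.
Proof.
  intros Cf x; unfold reflect.
  refine (continuous_opp (fun x => f (- x)) x _).
  refine (continuous_comp (fun x => - x) f x _ _); [| apply Cf].
  refine (continuous_opp (fun x => x) x _); apply continuous_id.
Qed.

Lemma incr_homeo_reflect (f g : R -> R) :
  incr_homeo f g -> incr_homeo (reflect f) (reflect g).
Proof.
  intros (Hf & Hgf & Hfg & Cf & Cg); repeat split;
    try (now apply continuous_reflect); unfold reflect.
  - intros x y H; apply Ropp_lt_contravar, Hf; lra.
  - intros x; rewrite Ropp_involutive, Hgf; ring.
  - intros x; rewrite Ropp_involutive, Hfg; ring.
Qed.

Lemma bs_reflect (a b : R -> R) : bs a b -> bs (reflect a) (reflect b).
Proof. intros H x; unfold reflect; now rewrite !Ropp_involutive, H. Qed.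

Lemma gap_reflect (f : R -> R) (p q : Rbar) :
  gap f p q -> gap (reflect f) (Rbar_opp q) (Rbar_opp p).
Proof.
  unfold gap, reflect; intros (H & Hp & Hq & N); repeat split.
  - now apply <- Rbar_opp_lt.
  - destruct q; simpl in *; auto; now rewrite Ropp_involutive, Hq.
  - destruct p; simpl in *; auto; now rewrite Ropp_involutive, Hp.
  - intros x Hx Hx' E.
    apply (N (- x)).
    + destruct p; simpl in *; auto; lra.
    + destruct q; simpl in *; auto; lra.
    + lra.
Qed.

(** * Existence and sign of gaps *)

Lemma not_fixed_near (f : R -> R) (r : R) :
  continuous f r -> f r <> r ->
  exists d, 0 < d /\ forall y, Rabs (y - r) < d -> f y <> y.
Proof.
  intros Cf N.
  assert (C : continuous (fun y => f y - y) r).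
  { refine (continuous_minus f (fun y => y) r _ _); auto; apply continuous_id. }
  assert (P : 0 < Rabs (f r - r)) by (apply Rabs_pos_lt; lra).
  destruct (proj1 (filterlim_locally _ _) C (mkposreal _ P)) as [d Hd].
  exists d; split; [apply cond_pos |].
  intros y Hy E.
  specialize (Hd y Hy).
  change (Rabs ((f y - y) - (f r - r)) < Rabs (f r - r)) in Hd.
  rewrite E in Hd.
  replace (y - y - (f r - r)) with (- (f r - r)) in Hd by ring.
  rewrite Rabs_Ropp in Hd; lra.
Qed.

(** The point [q] is the infimum of the fixed points to the right of [x]. It is itself fixed because
    Fix [f] is closed, and it is [p_infty] when there are none. *)
Lemma next_fixed (f : R -> R) (x : R) :
  (forall y, continuous f y) -> f x <> x ->
  exists q : Rbar, Rbar_lt x q /\ fixes f q /\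
    forall y : R, x <= y -> Rbar_lt y q -> f y <> y.
Proof.
  intros Cf N.
  set (E := fun y => x <= y /\ f y = y).
  destruct (Glb_Rbar_correct E) as [LB GLB].
  set (q := Glb_Rbar E) in *.
  assert (Hx : Rbar_le x q) by (apply GLB; intros y [Hy _]; exact Hy).
  assert (Hq : fixes f q).
  { destruct q as [r | |]; simpl; auto.
    destruct (Req_dec (f r) r) as [| Nr]; auto; exfalso.
    destruct (not_fixed_near f r (Cf r) Nr) as (d & Hd & Hn).
    assert (H : Rbar_le (r + d) r).
    { apply GLB; intros y Hy.
      generalize (LB y Hy); simpl; intros Hry.
      destruct (Rle_or_lt (r + d) y) as [| Hlt]; auto.
      exfalso; apply (Hn y); [| apply Hy].
      apply Rabs_def1; lra. }
    simpl in H; lra. }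
  exists q; repeat split; auto.
  - destruct q as [r | |]; simpl in *; auto.
    destruct Hx as [| <-]; auto; contradiction.
  - intros y Hy Hyq Ey.
    apply (Rbar_lt_not_le _ _ Hyq), LB; now split.
Qed.

Lemma prev_fixed (f : R -> R) (x : R) :
  (forall y, continuous f y) -> f x <> x ->
  exists p : Rbar, Rbar_lt p x /\ fixes f p /\
    forall y : R, Rbar_lt p y -> y <= x -> f y <> y.
Proof.
  intros Cf N.
  destruct (next_fixed (reflect f) (- x)) as (q & Hq & Fq & Nq).
  - now apply continuous_reflect.
  - unfold reflect; rewrite Ropp_involutive; lra.
  - exists (Rbar_opp q); repeat split.
    + destruct q; simpl in *; auto; lra.
    + unfold reflect in Fq; destruct q; simpl in *; auto; lra.
    + intros y Hy Hyx E; apply (Nq (- y)).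
      * lra.
      * destruct q; simpl in *; auto; lra.
      * unfold reflect; rewrite Ropp_involutive; lra.
Qed.

Lemma gap_exists (f : R -> R) (x : R) :
  (forall y, continuous f y) -> f x <> x ->
  exists p q, gap f p q /\ Rbar_lt p x /\ Rbar_lt x q.
Proof.
  intros Cf N.
  destruct (next_fixed f x Cf N) as (q & Hq & Fq & Nq).
  destruct (prev_fixed f x Cf N) as (p & Hp & Fp & Np).
  exists p, q; repeat split; auto.
  - now apply Rbar_lt_trans with x.
  - intros y H1 H2; destruct (Rle_or_lt x y); [now apply Nq | apply Np; auto; lra].
Qed.

Lemma fixed_between (f : R -> R) (x y : R) :
  (forall z, continuous f z) -> x <= f x -> f y <= y ->
  exists z, Rmin x y <= z <= Rmax x y /\ f z = z.
Proof.
  intros Cf Hx Hy.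
  destruct (IVT_gen (fun z => f z - z) x y 0) as (z & Hz & E).
  - intros z; apply continuity_pt_filterlim.
    refine (continuous_minus f (fun z => z) z _ _); [apply Cf | apply continuous_id].
  - unfold Rmin, Rmax; repeat destruct Rle_dec; lra.
  - exists z; split; auto; lra.
Qed.

Lemma Rbar_between (p q : Rbar) (x y z : R) :
  Rbar_lt p x -> Rbar_lt x q -> Rbar_lt p y -> Rbar_lt y q ->
  Rmin x y <= z <= Rmax x y -> Rbar_lt p z /\ Rbar_lt z q.
Proof.
  unfold Rmin, Rmax; destruct (Rle_dec x y); destruct p, q; simpl; intros;
    split; auto; lra.
Qed.

(** A change of sign of [f x - x] would give a zero inside the gap, by the intermediate value
    theorem. *)
Lemma gap_sign (f : R -> R) (p q : Rbar) :
  (forall z, continuous f z) -> gap f p q ->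
  (forall x : R, Rbar_lt p x -> Rbar_lt x q -> x < f x) \/
  (forall x : R, Rbar_lt p x -> Rbar_lt x q -> f x < x).
Proof.
  intros Cf (_ & _ & _ & N).
  apply NNPP; intros H; apply not_or_and in H as [H1 H2].
  apply H1; intros x Hx Hx'.
  destruct (Rtotal_order x (f x)) as [| [E | L]]; auto.
  { exfalso; now apply (N x). }
  exfalso; apply H2; intros y Hy Hy'.
  destruct (Rtotal_order y (f y)) as [L' | [E | L']]; auto;
    exfalso; [| now apply (N y)].
  destruct (fixed_between f y x Cf) as (z & Hz & E); try lra.
  destruct (Rbar_between p q y x z); auto.
  now apply (N z).
Qed.

Lemma fixes_inverse (f g : R -> R) (q : Rbar) :
  incr_homeo f g -> fixes f q -> fixes g q.
Proof.
  intros (_ & Hgf & _); destruct q as [r | |]; simpl; auto.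
  intros E; rewrite <- E at 1; apply Hgf.
Qed.

Lemma gap_inverse (f g : R -> R) (p q : Rbar) :
  incr_homeo f g -> gap f p q -> gap g p q.
Proof.
  intros Hf (H & Hp & Hq & N); repeat split; auto;
    try (now apply (fixes_inverse f g)).
  intros x Hx Hx' E; apply (N x); auto.
  rewrite <- E at 1; apply Hf.
Qed.

Lemma incr_between (f : R -> R) (p q : Rbar) (x : R) :
  incr f -> fixes f p -> fixes f q -> Rbar_lt p x -> Rbar_lt x q ->
  Rbar_lt p (f x) /\ Rbar_lt (f x) q.
Proof.
  intros Hf Hp Hq Hx Hx'; split.
  - destruct p as [r | |]; simpl in *; auto; rewrite <- Hp; now apply Hf.
  - destruct q as [r | |]; simpl in *; auto; rewrite <- Hq; now apply Hf.
Qed.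

(** * Orbits inside a gap *)

Lemma iter_between (f : R -> R) (p q : Rbar) (x : R) (n : nat) :
  incr f -> fixes f p -> fixes f q -> Rbar_lt p x -> Rbar_lt x q ->
  Rbar_lt p (Nat.iter n f x) /\ Rbar_lt (Nat.iter n f x) q.
Proof.
  intros; induction n as [| n [IH1 IH2]]; auto; rewrite Nat.iter_succ; now apply incr_between.
Qed.

Lemma iter_incr (f : R -> R) (n : nat) : incr f -> incr (Nat.iter n f).
Proof. intros Hf x y H; induction n; simpl; auto; now apply Hf. Qed.

Lemma iter_cancel (f g : R -> R) (n : nat) (x : R) :
  (forall x, g (f x) = x) -> Nat.iter n g (Nat.iter n f x) = x.
Proof.
  intros H; revert x; induction n as [| n IH]; intros x; auto.
  rewrite Nat.iter_succ_r; simpl; now rewrite H.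
Qed.

(* The supremum of a bounded orbit would be moved strictly past itself. *)
Lemma gap_cofinal (f g : R -> R) (p q : Rbar) (x y : R) :
  incr_homeo f g ->
  (forall x : R, Rbar_lt p x -> Rbar_lt x q -> x < f x) ->
  Rbar_lt p x -> Rbar_lt y q -> exists n, y < Nat.iter n f x.
Proof.
  intros (Hf & Hgf & Hfg & _) P Hx Hy.
  apply NNPP; intros N.
  assert (B : forall n, Nat.iter n f x <= y).
  { intros n; apply Rnot_lt_le; intros H; apply N; now exists n. }
  destruct (completeness (fun z => exists n, z = Nat.iter n f x)) as (s & U & L).
  - exists y; intros z (n & ->); apply B.
  - exists x; now exists 0%nat.
  - assert (Hs : x <= s) by (apply U; now exists 0%nat).
    assert (Hs' : s <= y) by (apply L; intros z (n & ->); apply B).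
    assert (Ps : s < f s).
    { apply P; [destruct p | destruct q]; simpl in *; auto; lra. }
    assert (H : s <= g s); [| apply (incr_le f _ _ Hf) in H; rewrite Hfg in H; lra].
    apply L; intros z (n & ->).
    apply Rnot_lt_le; intros H; apply Hf in H; rewrite Hfg in H.
    assert (f (Nat.iter n f x) <= s) by (apply U; now exists (S n)).
    lra.
Qed.

(** * The Baumslag-Solitar relation on a gap *)

Lemma bs_inverse (a b bi : R -> R) : incr_homeo b bi -> bs a b -> bs a bi.
Proof.
  intros (_ & H1 & H2 & _) H x.
  rewrite <- (H2 x) at 2; now rewrite H, !H1.
Qed.

Lemma bs_iter (a b : R -> R) (n : nat) (x : R) :
  bs a b -> a (Nat.iter n b x) = Nat.iter n b (Nat.iter n b (a x)).
Proof.
  intros H; induction n as [| n IH]; auto.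
  simpl; rewrite H, IH.
  now rewrite <- (Nat.iter_succ n _ b (Nat.iter n b (a x))), Nat.iter_succ_r.
Qed.

(** The relation sends Fix [b] into the fixed set of the square of [b], which equals Fix [b] since
    an increasing map has no orbit of period two. *)
Lemma bs_fixed (a b : R -> R) (r : R) : incr b -> bs a b -> b r = r -> b (a r) = a r.
Proof.
  intros Hb H E; apply incr_fix_square; auto; now rewrite <- H, E.
Qed.

Lemma bs_fixed_inverse (a ai b : R -> R) (r : R) :
  incr_homeo a ai -> bs a b -> b r = r -> b (ai r) = ai r.
Proof.
  intros (_ & H1 & H2 & _) H E.
  rewrite <- (H1 (b (ai r))), H, H2, E, E; reflexivity.
Qed.

(** Both [a] and [ai] preserve Fix [b] and fix [q], so neither can move [p] into the gap. Hence
    [a p <= p] and [ai p <= p], which forces equality. *)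
Lemma gap_left_invariant (a ai b : R -> R) (p q : Rbar) :
  incr_homeo a ai -> incr b -> bs a b -> gap b p q -> fixes a q -> fixes a p.
Proof.
  intros Ha Hb H (Hpq & Fp & Fq & N) Hq.
  destruct p as [r | |]; simpl in *; auto.
  assert (Hai := incr_homeo_sym _ _ Ha).
  assert (Hq' := fixes_inverse _ _ _ Ha Hq).
  assert (L : forall c, incr c -> fixes c q -> b (c r) = c r -> c r <= r).
  { intros c Hc Cq E; apply Rnot_lt_le; intros Hr; apply (N (c r)); auto.
    destruct q as [s | |]; simpl in *; auto; rewrite <- Cq; now apply Hc. }
  apply Rle_antisym.
  - apply L; [apply Ha | auto | now apply bs_fixed].
  - assert (Hr : ai r <= r).
    { apply L; [apply Hai | auto | now apply (bs_fixed_inverse a)]. }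
    apply (incr_le a) in Hr; [| apply Ha].
    destruct Ha as (_ & _ & E & _); now rewrite E in Hr.
Qed.

(* On a gap of [b] preserved by [a], the pair acts like [x -> x + 1] and
   [x -> 2 x]: comparing [a] with the orbits of [b] gives a fixed point [z] of
   [a], and then [a (b^k z) = b^(2k) z] shows that [a] moves all points close
   to the right end [q]. *)
Lemma descent_pos (a ai b bi : R -> R) (p q : Rbar) :
  incr_homeo a ai -> incr_homeo b bi -> bs a b -> gap b p q -> fixes a q ->
  (forall x : R, Rbar_lt p x -> Rbar_lt x q -> x < b x) ->
  exists p' : R, Rbar_lt p p' /\ gap a p' q.
Proof.
  intros Ha Hb H G Hq P.
  assert (Hp : fixes a p) by (apply (gap_left_invariant a ai b p q); auto; apply Hb).
  assert (Hbi := incr_homeo_sym _ _ Hb).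
  assert (G' := gap_inverse _ _ _ _ Hb G).
  assert (H' := bs_inverse _ _ _ Hb H).
  destruct G as (Hpq & Fp & Fq & N).
  assert (Z : exists z : R, Rbar_lt p z /\ Rbar_lt z q /\ a z = z).
  { assert (X : exists x : R, Rbar_lt p x /\ Rbar_lt x q).
    { destruct p as [r | |], q as [s | |]; simpl in *; try contradiction.
      - exists ((r + s) / 2); lra.
      - exists (r + 1); split; auto; lra.
      - exists (s - 1); split; auto; lra.
      - now exists 0. }
    destruct X as (x & Hx & Hx').
    destruct (incr_between a p q x) as [A A']; auto; [apply Ha |].
    (* If [a x < x < b^n (a x)], then [a (b^n x) = b^(2n) (a x)] lies beyond [b^n x], so [a] has a
       fixed point between [x] and [b^n x]. If [x < a x], powers of [bi] serve in the same way. *)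
    destruct (Rtotal_order (a x) x) as [L | [E | L]]; [| now exists x |].
    - destruct (gap_cofinal b bi p q (a x) x) as (n & Hn); auto.
      destruct (iter_between b p q x n) as [B B']; auto; [apply Hb |].
      destruct (fixed_between a (Nat.iter n b x) x) as (z & Hz & E); try lra.
      + apply Ha.
      + rewrite bs_iter by auto.
        apply incr_le; [apply iter_incr, Hb | lra].
      + exists z; destruct (Rbar_between p q (Nat.iter n b x) x z); auto.
    - destruct (gap_cofinal b bi p q x (a x)) as (n & Hn); auto.
      destruct (iter_between bi p q x n) as [B B']; try apply G'; auto; [apply Hbi |].
      destruct (fixed_between a x (Nat.iter n bi x)) as (z & Hz & E); try lra.
      + apply Ha.
      + rewrite bs_iter by auto.
        apply incr_le; [apply iter_incr, Hbi |].
        apply Rle_trans with (Nat.iter n bi (Nat.iter n b x)).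
        * apply incr_le; [apply iter_incr, Hbi | lra].
        * rewrite iter_cancel by apply Hb; lra.
      + exists z; destruct (Rbar_between p q x (Nat.iter n bi x) z); auto. }
  destruct Z as (z & Hz & Hz' & Ez).
  destruct (incr_between b p q z) as [B B']; auto; [apply Hb |].
  assert (M : forall x : R, b z <= x -> Rbar_lt x q -> x < a x).
  { intros x Hx Hx'.
    destruct (gap_cofinal b bi p q z x) as (n & Hn); auto.
    (* Then [a x >= b^(2k+2) z >= b^(k+2) z > x]. Starting at [b z] rather than [z] ensures that
       doubling the exponent gains at least one step. *)
    assert (K : exists k, Nat.iter (S k) b z <= x < Nat.iter (S (S k)) b z).
    { clear - Hx Hn P Hz Hz'.
      induction n as [| n IH].
      - simpl in Hn; specialize (P z Hz Hz'); lra.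
      - destruct (Rlt_or_le x (Nat.iter n b z)) as [L | L]; auto.
        destruct n as [| n]; [simpl in *; lra |].
        now exists n. }
    destruct K as (k & K1 & K2).
    apply (incr_le a) in K1; [| apply Ha].
    rewrite bs_iter, Ez in K1 by auto.
    rewrite Nat.iter_succ in K1.
    assert (Nat.iter (S (S k)) b z <= b (Nat.iter k b (Nat.iter (S k) b z))); [| lra].
    rewrite Nat.iter_succ.
    apply incr_le; [apply Hb |].
    clear - P Hz Hz' Hb Fp Fq.
    assert (Q : forall m (y : R), Rbar_lt p y -> Rbar_lt y q -> y <= Nat.iter m b y).
    { induction m as [| m IH]; intros y Hy Hy'; [apply Rle_refl |].
      specialize (IH y Hy Hy'); simpl.
      destruct (iter_between b p q y m) as [I1 I2]; auto; [apply Hb |].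
      specialize (P _ I1 I2); lra. }
    destruct (iter_between b p q z (S k)) as [I1 I2]; auto; apply Hb. }
  (* The last fixed point of [a] before [b z] is at least [z], hence strictly to the right of
     [p]. *)
  destruct (prev_fixed a (b z)) as (p' & Hp' & Fp' & Np').
  { apply Ha. }
  { specialize (M (b z)); intros E; rewrite E in M; apply (Rlt_irrefl (b z)), M; auto; lra. }
  assert (Hzp : Rbar_le z p').
  { apply Rbar_not_lt_le; intros L; apply (Np' z); auto.
    left; now apply P. }
  destruct p' as [r | |]; simpl in *; try contradiction.
  exists r; split; [destruct p; simpl in *; auto; lra |].
  repeat split; auto.
  - destruct q; simpl in *; auto; lra.
  - intros x Hx Hx'.
    destruct (Rle_or_lt x (b z)); [now apply Np' |].
    apply Rgt_not_eq, M; auto; lra.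
Qed.

(** When [b] moves points of the gap to the left, its inverse moves them to the right, has the same
    gap and satisfies the same relation with [a]. *)
Lemma descent (a ai b bi : R -> R) (p q : Rbar) :
  incr_homeo a ai -> incr_homeo b bi -> bs a b -> gap b p q -> fixes a q ->
  exists p' : R, Rbar_lt p p' /\ gap a p' q.
Proof.
  intros Ha Hb H G Hq.
  destruct (gap_sign b p q) as [P | P]; auto; [apply Hb | |].
  - now apply (descent_pos a ai b bi).
  - apply (descent_pos a ai bi b); auto.
    + now apply incr_homeo_sym.
    + now apply (bs_inverse a b).
    + now apply (gap_inverse b).
    + intros x Hx Hx'.
      destruct (incr_between bi p q x) as [B B']; auto.
      * now apply (incr_homeo_sym b).
      * apply (fixes_inverse b bi p); auto; apply G.
      * apply (fixes_inverse b bi q); auto; apply G.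
      * specialize (P _ B B'); destruct Hb as (_ & _ & E & _); now rewrite E in P.
Qed.

(* Going once around the cycle [a1, a0, a3, a2, a1] produces a second gap of
   [a1] with the same right end but a strictly larger left end. *)
Lemma no_gap_cycle (a0 a1 a2 a3 b0 b1 b2 b3 : R -> R) (q : Rbar) :
  incr_homeo a0 b0 -> incr_homeo a1 b1 -> incr_homeo a2 b2 -> incr_homeo a3 b3 ->
  bs a0 a1 -> bs a1 a2 -> bs a2 a3 -> bs a3 a0 ->
  (forall p, gap a1 p q -> fixes a0 q) -> (forall p, gap a2 p q -> fixes a1 q) ->
  (forall p, gap a3 p q -> fixes a2 q) -> (forall p, gap a0 p q -> fixes a3 q) ->
  forall p, ~ gap a1 p q.
Proof.
  intros H0 H1 H2 H3 R0 R1 R2 R3 F0 F1 F2 F3 p G1.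
  destruct (descent a0 b0 a1 b1 p q) as (p0 & L0 & G0); eauto.
  destruct (descent a3 b3 a0 b0 p0 q) as (p3 & L3 & G3); eauto.
  destruct (descent a2 b2 a3 b3 p3 q) as (p2 & L2 & G2); eauto.
  destruct (descent a1 b1 a2 b2 p2 q) as (p1 & L1 & G1'); eauto.
  destruct G1 as (_ & _ & _ & N), G1' as (L & E & _).
  apply (N p1); auto.
  simpl in *; destruct p; simpl in *; auto; lra.
Qed.

(** * The C^1 estimate *)

(* Unqualified, [C1] would be the one of [Reals.Cos_rel]. *)
Lemma C1_near (f : R -> R) (c e : R) : Defs.C1 f -> 0 < e ->
  exists d, 0 < d /\ forall y, Rabs (y - c) < d -> Rabs (Derive f y - Derive f c) < e.
Proof.
  intros Cf He.
  destruct (proj1 (filterlim_locally _ _) (proj2 (Cf c)) (mkposreal _ He)) as [d Hd].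
  exists d; split; [apply cond_pos | exact Hd].
Qed.

Lemma C1_continuous (f : R -> R) (x : R) : Defs.C1 f -> continuous f x.
Proof. intros Cf; exact (ex_derive_continuous f x (proj1 (Cf x))). Qed.

Lemma C1_mvt (f : R -> R) (x y : R) : Defs.C1 f ->
  exists z, Rmin x y <= z <= Rmax x y /\ f y - f x = Derive f z * (y - x).
Proof.
  intros Cf; apply MVT_gen; intros z _.
  - apply Derive_correct, Cf.
  - apply continuity_pt_filterlim, C1_continuous, Cf.
Qed.

Lemma is_lim_seq_near (u : nat -> R) (c d : R) : is_lim_seq u c -> 0 < d ->
  exists N, forall n, (N <= n)%nat -> Rabs (u n - c) < d.
Proof.
  intros Hu Hd; apply is_lim_seq_spec in Hu.
  destruct (Hu (mkposreal _ Hd)) as [N HN]; now exists N.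
Qed.

Lemma near_between (c d x y z : R) :
  Rabs (x - c) < d -> Rabs (y - c) < d -> Rmin x y <= z <= Rmax x y ->
  Rabs (z - c) < d.
Proof.
  intros Hx Hy Hz.
  apply Rabs_def2 in Hx; apply Rabs_def2 in Hy; apply Rabs_def1;
    unfold Rmin, Rmax in Hz; destruct (Rle_dec x y); lra.
Qed.

Lemma Diff1R_sym (f g : R -> R) : Diff1R f g -> Diff1R g f.
Proof. unfold Diff1R; tauto. Qed.

(** The chain rule for the inverse excludes a zero derivative. A negative one would stay negative
    nearby and contradict monotonicity through the mean value theorem. *)
Lemma incr_derive_pos (f g : R -> R) (x : R) : Diff1R f g -> incr f -> 0 < Derive f x.
Proof.
  intros (Cf & Cg & Hgf & _) Hf.
  assert (E : Derive f x * Derive g (f x) = 1).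
  { rewrite <- Derive_comp; [| apply Cg | apply Cf].
    rewrite (Derive_ext _ (fun y => y)) by auto; apply Derive_id. }
  destruct (Rtotal_order 0 (Derive f x)) as [| [Z | L]]; auto; exfalso.
  - rewrite <- Z in E; lra.
  - destruct (C1_near f x (- Derive f x)) as (d & Hd & Hn); auto; [lra |].
    destruct (C1_mvt f x (x + d / 2)) as (z & Hz & M); auto.
    assert (Nz : Rabs (Derive f z - Derive f x) < - Derive f x).
    { apply Hn, (near_between x d x (x + d / 2)); auto; apply Rabs_def1; lra. }
    apply Rabs_def2 in Nz.
    assert (Hx : f x < f (x + d / 2)) by (apply Hf; lra).
    nra.
Qed.

(* Let [P n], [Q n] be the images of [p], [q] under the [n]-th iterate of [ai]
   and follow one point of the gap.  Since [b] fixes every [P n] and [Q n], its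
   derivative at [c] is 1, so near [c] one application of [ai] multiplies
   displacements [|b x - x|] by about [2 * Derive ai c], because it carries
   [b^2] to [b], but lengths [Q n - P n] only by about [Derive ai c].  This is
   absurd, as a displacement never exceeds the length. *)
Lemma no_wandering_gap (a ai b : R -> R) (p q x c : R) :
  incr_homeo a ai -> incr b -> Diff1R a ai -> Defs.C1 b -> bs a b ->
  b p = p -> b q = q -> p < x < q -> b x <> x ->
  is_lim_seq (fun n => Nat.iter n ai p) c ->
  is_lim_seq (fun n => Nat.iter n ai q) c -> False.
Proof.
  intros Ha Hb Da Cb H Ep Eq Hx Nx Lp Lq.
  assert (Hai := incr_homeo_sym _ _ Ha).
  assert (Cai : Defs.C1 ai) by apply Da.
  assert (l_pos : 0 < Derive ai c).
  { apply (incr_derive_pos ai a); [now apply Diff1R_sym | apply Hai]. }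
  set (P := fun n => Nat.iter n ai p) in *.
  set (Q := fun n => Nat.iter n ai q) in *.
  set (X := fun n => Nat.iter n ai x).
  assert (FP : forall n, b (P n) = P n).
  { induction n as [| n IH]; auto; exact (bs_fixed_inverse a ai b _ Ha H IH). }
  assert (FQ : forall n, b (Q n) = Q n).
  { induction n as [| n IH]; auto; exact (bs_fixed_inverse a ai b _ Ha H IH). }
  assert (PX : forall n, P n < X n) by (intros n; apply iter_incr; [apply Hai | lra]).
  assert (XQ : forall n, X n < Q n) by (intros n; apply iter_incr; [apply Hai | lra]).
  assert (near : forall d, 0 < d -> exists N, forall n, (N <= n)%nat ->
    forall z, P n <= z <= Q n -> Rabs (z - c) < d).
  { intros d Hd.
    destruct (is_lim_seq_near P c d Lp Hd) as [N1 H1].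
    destruct (is_lim_seq_near Q c d Lq Hd) as [N2 H2].
    exists (N1 + N2)%nat; intros n Hn z Hz.
    apply (near_between c d (P n) (Q n)); [apply H1; lia | apply H2; lia |].
    specialize (PX n); specialize (XQ n).
    rewrite Rmin_left, Rmax_right; lra. }
  (* Since [b] fixes [P n] and [Q n], its derivative equals 1 somewhere between them, hence at
     points arbitrarily close to [c]. *)
  assert (Db : Derive b c = 1).
  { apply NNPP; intros N1.
    assert (He : 0 < Rabs (Derive b c - 1)) by (apply Rabs_pos_lt; lra).
    destruct (C1_near b c _ Cb He) as (d & Hd & Hn).
    destruct (near d Hd) as [N HN].
    destruct (C1_mvt b (P N) (Q N) Cb) as (z & Hz & M).
    specialize (PX N); specialize (XQ N).
    rewrite Rmin_left, Rmax_right in Hz by lra.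
    rewrite FP, FQ in M.
    assert (E : Derive b z = 1) by nra.
    specialize (Hn z (HN N (le_n _) z Hz)).
    rewrite E, Rabs_minus_sym in Hn; lra. }
  destruct (C1_near b c (1 / 10) Cb) as (d1 & Hd1 & N1); [lra |].
  destruct (C1_near ai c (Derive ai c / 10) Cai) as (d2 & Hd2 & N2); [lra |].
  set (l := Derive ai c) in *; rewrite Db in N1.
  destruct (near d1 Hd1) as [M1 near1]; destruct (near d2 Hd2) as [M2 near2].
  set (N := (M1 + M2)%nat).
  set (D := fun n => Rabs (b (X n) - X n)).
  set (L := fun n => Q n - P n).
  (* The constant is [9/10 * 19/10], from lower bounds for [Derive ai w] and [1 + Derive b z]. The
     second factor arises from [b (b y) - y = (b (b y) - b y) + (b y - y)]. *)
  assert (stepX : forall n, (N <= n)%nat -> 171 / 100 * l * D n <= D (S n)).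
  { intros n Hn.
    assert (I : forall y, P n < y < Q n -> P n < b y < Q n).
    { intros y Hy; rewrite <- (FP n), <- (FQ n); split; apply Hb; lra. }
    assert (I0 : P n < X n < Q n) by auto.
    assert (I1 := I _ I0); assert (I2 := I _ I1).
    destruct (C1_mvt b (X n) (b (X n)) Cb) as (z & Hz & Ez).
    destruct (C1_mvt ai (X n) (b (b (X n))) Cai) as (w & Hw & Ew).
    assert (Bz : Rabs (Derive b z - 1) < 1 / 10).
    { apply N1, (near_between c d1 (X n) (b (X n))); auto;
        apply (near1 n); try lra; unfold N in Hn; lia. }
    assert (Bw : Rabs (Derive ai w - l) < l / 10).
    { apply N2, (near_between c d2 (X n) (b (b (X n)))); auto;
        apply (near2 n); try lra; unfold N in Hn; lia. }
    apply Rabs_def2 in Bz; apply Rabs_def2 in Bw.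
    assert (E : b (X (S n)) - X (S n) =
      Derive ai w * (1 + Derive b z) * (b (X n) - X n)).
    { change (X (S n)) with (ai (X n)).
      replace (b (ai (X n))) with (ai (b (b (X n)))).
      - rewrite Ew; replace (b (b (X n)) - X n) with
          ((b (b (X n)) - b (X n)) + (b (X n) - X n)) by ring.
        rewrite Ez; ring.
      - destruct Ha as (_ & A1 & A2 & _).
        rewrite <- (A2 (X n)) at 1; rewrite <- H; apply A1. }
    unfold D; rewrite E, Rabs_mult.
    apply Rmult_le_compat_r; [apply Rabs_pos |].
    rewrite Rabs_pos_eq; nra. }
  assert (stepL : forall n, (N <= n)%nat -> L (S n) <= 11 / 10 * l * L n).
  { intros n Hn.
    destruct (C1_mvt ai (P n) (Q n) Cai) as (w & Hw & Ew).
    specialize (PX n); specialize (XQ n).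
    rewrite Rmin_left, Rmax_right in Hw by lra.
    assert (Bw : Rabs (Derive ai w - l) < l / 10).
    { apply N2, (near2 n); auto; unfold N in Hn; lia. }
    apply Rabs_def2 in Bw.
    unfold L; change (Q (S n)) with (ai (Q n)); change (P (S n)) with (ai (P n)).
    rewrite Ew; apply Rmult_le_compat_r; lra. }
  assert (D_le_L : forall n, D n <= L n).
  { intros n; unfold D, L; apply Rabs_le.
    assert (P n < b (X n)) by (rewrite <- (FP n); now apply Hb).
    assert (b (X n) < Q n) by (rewrite <- (FQ n); now apply Hb).
    specialize (PX n); specialize (XQ n); lra. }
  assert (L_pos : forall n, 0 < L n).
  { intros n; unfold L; specialize (PX n); specialize (XQ n); lra. }
  assert (DN : 0 < D N).
  { apply Rabs_pos_lt; intros E; apply Nx.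
    (* Applying [a] repeatedly would carry a fixed point [X n] of [b] back to a fixed point [x]. *)
    assert (F : forall n, b (X n) = X n -> b x = x).
    { induction n as [| n IH]; auto; intros F; apply IH.
      apply (bs_fixed a b _ Hb H) in F.
      change (X (S n)) with (ai (X n)) in F.
      destruct Ha as (_ & _ & A2 & _); now rewrite A2 in F. }
    apply (F N); lra. }
  (* As [171/100] exceeds [3/2 * 11/10], the ratio [D / L] grows by a factor of at least [3/2] per
     step; the bound is cross-multiplied. *)
  assert (growth : forall k, (3 / 2) ^ k * D N * L (k + N)%nat <= D (k + N)%nat * L N).
  { induction k as [| k IH]; [simpl; lra |].
    specialize (stepX (k + N)%nat ltac:(lia)); specialize (stepL (k + N)%nat ltac:(lia)).
    change (S k + N)%nat with (S (k + N)).
    assert (Hk : 0 < (3 / 2) ^ k) by (apply pow_lt; lra).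
    assert (T := L_pos N); assert (T' := L_pos (k + N)%nat).
    simpl pow.
    apply Rle_trans with (171 / 100 * l * D (k + N)%nat * L N);
      [| apply Rmult_le_compat_r; lra].
    apply Rle_trans with (171 / 100 * l * ((3 / 2) ^ k * D N * L (k + N)%nat)); [| nra].
    apply Rle_trans with (3 / 2 * (3 / 2) ^ k * D N * (11 / 10 * l * L (k + N)%nat)).
    - apply Rmult_le_compat_l; auto; nra.
    - assert (0 <= l * ((3 / 2) ^ k * D N * L (k + N)%nat)); [| lra].
      repeat (apply Rmult_le_pos || lra). }
  destruct (Pow_x_infinity (3 / 2) ltac:(rewrite Rabs_pos_eq; lra) (L N / D N + 1))
    as [k Hk].
  specialize (Hk k (le_n _)).
  rewrite Rabs_pos_eq in Hk by (apply pow_le; lra).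
  specialize (growth k); specialize (D_le_L (k + N)%nat).
  assert (T := L_pos (k + N)%nat); assert (T' := L_pos N).
  assert (B : (3 / 2) ^ k * D N <= L N).
  { apply Rmult_le_reg_r with (L (k + N)%nat); auto; nra. }
  assert (E : L N / D N * D N = L N) by (field; lra).
  nra.
Qed.

(** * Invariance of finite right ends *)

Lemma gap_limit_right (f g : R -> R) (p : Rbar) (c x : R) :
  incr_homeo f g -> gap f p c ->
  (forall y : R, Rbar_lt p y -> Rbar_lt y c -> y < f y) ->
  Rbar_lt p x -> x < c -> is_lim_seq (fun n => Nat.iter n f x) c.
Proof.
  intros Hf (Hpc & Fp & Fc & _) P Hx Hx'.
  apply is_lim_seq_spec; intros e.
  destruct (gap_cofinal f g p c x (c - e)) as (N & HN); auto.
  { simpl; destruct e; simpl; lra. }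
  exists N; intros n Hn.
  assert (B : forall n, Rbar_lt p (Nat.iter n f x) /\ Rbar_lt (Nat.iter n f x) c).
  { intros m; apply iter_between; auto; apply Hf. }
  assert (M : Nat.iter N f x <= Nat.iter n f x).
  { induction Hn as [| n Hn IH]; [lra |].
    destruct (B n) as [B1 B2]; specialize (P _ B1 B2).
    rewrite Nat.iter_succ; lra. }
  destruct (B n) as [_ B2]; simpl in B2.
  destruct e as [e He]; simpl in *; apply Rabs_def1; lra.
Qed.

Lemma iter_reflect (f : R -> R) (n : nat) (x : R) :
  Nat.iter n (reflect f) (- x) = - Nat.iter n f x.
Proof.
  induction n as [| n IH]; auto.
  rewrite !Nat.iter_succ, IH; unfold reflect; now rewrite Ropp_involutive.
Qed.

Lemma gap_limit_left (f g : R -> R) (q : Rbar) (c x : R) :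
  incr_homeo f g -> gap f c q ->
  (forall y : R, Rbar_lt c y -> Rbar_lt y q -> f y < y) ->
  c < x -> Rbar_lt x q -> is_lim_seq (fun n => Nat.iter n f x) c.
Proof.
  intros Hf G P Hx Hx'.
  apply is_lim_seq_ext with (fun n => - Nat.iter n (reflect f) (- x)).
  { intros n; rewrite iter_reflect; ring. }
  replace (Finite c) with (Rbar_opp (- c)) by (simpl; f_equal; ring).
  apply -> is_lim_seq_opp.
  apply (gap_limit_right (reflect f) (reflect g) (Rbar_opp q)).
  - now apply incr_homeo_reflect.
  - now apply gap_reflect in G.
  - intros y Hy Hy'; unfold reflect.
    assert (f (- y) < - y); [| lra].
    apply P; [simpl in *; lra |].
    destruct q; simpl in *; auto; lra.
  - destruct q; simpl in *; auto; lra.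
  - lra.
Qed.

(** Otherwise [q] lies in a gap [(u, v)] of [a], and the iterates of [ai] bring [p] and [q] to the
    same end of it, against [no_wandering_gap]. That end is finite because [a] has no gap reaching
    infinity. *)
Lemma gap_right_end_fixed (a ai b bi : R -> R) (p q : R) :
  incr_homeo a ai -> incr_homeo b bi -> Diff1R a ai -> Defs.C1 b -> bs a b ->
  (forall r, ~ gap a r p_infty) -> (forall r, ~ gap a m_infty r) ->
  gap b p q -> a q = q.
Proof.
  intros Ha Hb Da Cb H Np Nm (Hpq & Fp & Fq & N); simpl in Hpq, Fp, Fq.
  apply NNPP; intros Nq.
  assert (Hai := incr_homeo_sym _ _ Ha).
  assert (Ca : forall x, continuous a x) by apply Ha.
  destruct (gap_exists a q Ca Nq) as (u & v & G & Hu & Hv).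
  assert (G' := gap_inverse _ _ _ _ Ha G).
  assert (W : forall r, is_lim_seq (fun n => Nat.iter n ai p) (Finite r) ->
    is_lim_seq (fun n => Nat.iter n ai q) r -> False).
  { intros r; apply (no_wandering_gap a ai b p q ((p + q) / 2)); auto; try lra.
    - apply Hb.
    - apply N; simpl; lra. }
  (* This puts [p] in the gap of [a] as well: whichever of [a] and [ai] moves [q] to the left sends
     it to a fixed point [r] of [b] with [u < r], and [r <= p] since [b] has no fixed point in
     [(p, q)]. *)
  assert (B : forall r, r < q -> b r = r -> Rbar_lt u r -> Rbar_lt u p).
  { intros r Hr Er Hur.
    assert (r <= p) by (apply Rnot_lt_le; intros Hpr; now apply (N r)).
    destruct u; simpl in *; auto; lra. }
  assert (Hpv : Rbar_lt p v) by (destruct v; simpl in *; auto; lra).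
  destruct (gap_sign a u v Ca G) as [P | P].
  - destruct u as [r | |]; [| contradiction | now apply (Nm v)].
    assert (Pi : forall y : R, Rbar_lt r y -> Rbar_lt y v -> ai y < y).
    { intros y Hy Hy'.
      destruct (incr_between ai r v y) as [I1 I2]; try apply G'; auto; [apply Hai |].
      specialize (P _ I1 I2); destruct Ha as (_ & _ & E & _); now rewrite E in P. }
    assert (Hup : r < p).
    { apply (B (ai q)); [now apply Pi | now apply (bs_fixed_inverse a) |].
      apply (incr_between ai r v q); try apply G'; auto; apply Hai. }
    apply (W r); now apply (gap_limit_left ai a v).
  - destruct v as [r | |]; [| now apply (Np u) | contradiction].
    assert (Pi : forall y : R, Rbar_lt u y -> Rbar_lt y r -> y < ai y).
    { intros y Hy Hy'.
      destruct (incr_between ai u r y) as [I1 I2]; try apply G'; auto; [apply Hai |].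
      specialize (P _ I1 I2); destruct Ha as (_ & _ & E & _); now rewrite E in P. }
    assert (Hup : Rbar_lt u p).
    { apply (B (a q)); [now apply P | apply bs_fixed; auto; apply Hb |].
      apply (incr_between a u r q); try apply G; auto; apply Ha. }
    apply (W r); now apply (gap_limit_right ai a u).
Qed.

(** * Higman's group on the line *)

Definition higman_homeos (a0 a1 a2 a3 b0 b1 b2 b3 : R -> R) : Prop :=
  incr_homeo a0 b0 /\ incr_homeo a1 b1 /\ incr_homeo a2 b2 /\ incr_homeo a3 b3 /\
  bs a0 a1 /\ bs a1 a2 /\ bs a2 a3 /\ bs a3 a0.

(** At an infinite end the invariance demanded by [no_gap_cycle] is automatic; reflection turns the
    left end into a right one. *)
Lemma higman_no_gap_infinity (a0 a1 a2 a3 b0 b1 b2 b3 : R -> R) :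
  higman_homeos a0 a1 a2 a3 b0 b1 b2 b3 ->
  (forall p, ~ gap a1 p p_infty) /\ (forall q, ~ gap a1 m_infty q).
Proof.
  intros (H0 & H1 & H2 & H3 & R0 & R1 & R2 & R3); split.
  - apply (no_gap_cycle a0 a1 a2 a3 b0 b1 b2 b3); simpl; auto.
  - intros q G; apply gap_reflect in G; revert G.
    apply (no_gap_cycle (reflect a0) (reflect a1) (reflect a2) (reflect a3)
             (reflect b0) (reflect b1) (reflect b2) (reflect b3)); simpl; auto;
      (apply incr_homeo_reflect || apply bs_reflect); auto.
Qed.

Lemma higman_rotate (a0 a1 a2 a3 b0 b1 b2 b3 : R -> R) :
  higman_homeos a0 a1 a2 a3 b0 b1 b2 b3 -> higman_homeos a1 a2 a3 a0 b1 b2 b3 b0.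
Proof. unfold higman_homeos; tauto. Qed.

(** Infinite gaps are excluded for all four generators first, because the invariance of finite right
    ends relies on it. *)
Lemma higman_line_incr (a0 a1 a2 a3 b0 b1 b2 b3 : R -> R) :
  higman_homeos a0 a1 a2 a3 b0 b1 b2 b3 ->
  Diff1R a0 b0 -> Diff1R a1 b1 -> Diff1R a2 b2 -> Diff1R a3 b3 ->
  forall x, a1 x = x.
Proof.
  intros H D0 D1 D2 D3 x.
  destruct (higman_no_gap_infinity _ _ _ _ _ _ _ _ H) as [P1 M1].
  assert (H' := higman_rotate _ _ _ _ _ _ _ _ H).
  destruct (higman_no_gap_infinity _ _ _ _ _ _ _ _ H') as [P2 M2].
  apply higman_rotate in H'.
  destruct (higman_no_gap_infinity _ _ _ _ _ _ _ _ H') as [P3 M3].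
  apply higman_rotate in H'.
  destruct (higman_no_gap_infinity _ _ _ _ _ _ _ _ H') as [P0 M0].
  clear H'; destruct H as (H0 & H1 & H2 & H3 & R0 & R1 & R2 & R3).
  assert (K : forall a ai b bi, incr_homeo a ai -> incr_homeo b bi ->
    Diff1R a ai -> Diff1R b bi -> bs a b ->
    (forall p, ~ gap a p p_infty) -> (forall q, ~ gap a m_infty q) ->
    (forall p, ~ gap b p p_infty) -> (forall q, ~ gap b m_infty q) ->
    forall p q, gap b p q -> fixes a q).
  { intros a ai b bi Ha Hb Da Db R P M P' M' p q G.
    destruct q as [q | |]; simpl; auto.
    destruct p as [p | |]; [| destruct G as [[] _] | now elim (M' q)].
    apply (gap_right_end_fixed a ai b bi p q); auto; apply Db. }
  apply NNPP; intros N.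
  destruct (gap_exists a1 x) as (p & q & G & _); [apply H1 | auto |].
  revert G; apply (no_gap_cycle a0 a1 a2 a3 b0 b1 b2 b3); eauto.
Qed.

(** The derivative is continuous and never zero, so it has constant sign. *)
Lemma Diff1R_monotone (f g : R -> R) :
  Diff1R f g -> incr f \/ (forall x y, x < y -> f y < f x).
Proof.
  intros D; assert (D' := D); destruct D' as (Cf & Cg & Hgf & _).
  assert (Nz : forall x, Derive f x <> 0).
  { intros x Z.
    assert (E : Derive f x * Derive g (f x) = 1).
    { rewrite <- Derive_comp; [| apply Cg | apply Cf].
      rewrite (Derive_ext _ (fun y => y)) by auto; apply Derive_id. }
    rewrite Z in E; lra. }
  assert (S : forall x y, ~ (Derive f x < 0 < Derive f y)).
  { intros x y Hxy.
    destruct (IVT_gen (Derive f) x y 0) as (z & _ & E); [| | now apply (Nz z)].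
    - intros z; apply continuity_pt_filterlim, Cf.
    - rewrite Rmin_left, Rmax_right; lra. }
  destruct (Rlt_or_le 0 (Derive f 0)) as [L | L]; [left | right];
    intros x y Hxy; destruct (C1_mvt f x y Cf) as (z & _ & E).
  - assert (0 < Derive f z).
    { specialize (S z 0); specialize (Nz z); lra. }
    nra.
  - assert (Derive f z < 0).
    { specialize (S 0 z); assert (N0 := Nz 0); specialize (Nz z); lra. }
    nra.
Qed.

(** If [b] were decreasing, the left side of the relation would have the opposite monotonicity to
    [a], and the right side the same as [a]. The constant [k] accommodates lifts of circle maps. *)
Lemma conjugate_to_square_incr (a ai b bi : R -> R) (k : R) :
  Diff1R a ai -> Diff1R b bi -> (forall x, a (b x) = b (b (a x)) + k) -> incr b.
Proof.
  intros Da Db H.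
  destruct (Diff1R_monotone b bi Db) as [| Hb]; auto; exfalso.
  assert (H01 : 0 < 1) by lra.
  assert (E0 := H 0); assert (E1 := H 1).
  destruct (Diff1R_monotone a ai Da) as [Ha | Ha].
  - assert (A := Ha _ _ (Hb _ _ H01)); assert (B := Hb _ _ (Hb _ _ (Ha _ _ H01))); lra.
  - assert (A := Ha _ _ (Hb _ _ H01)); assert (B := Hb _ _ (Hb _ _ (Ha _ _ H01))); lra.
Qed.

Lemma Diff1R_incr_homeo (f g : R -> R) : Diff1R f g -> incr f -> incr_homeo f g.
Proof.
  intros (Cf & Cg & Hgf & Hfg) Hf; repeat split; auto;
    intros x; now apply C1_continuous.
Qed.

Lemma higman_line (a0 a1 a2 a3 b0 b1 b2 b3 : R -> R) :
  Diff1R a0 b0 -> Diff1R a1 b1 -> Diff1R a2 b2 -> Diff1R a3 b3 ->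
  bs a0 a1 -> bs a1 a2 -> bs a2 a3 -> bs a3 a0 ->
  (forall x, a0 x = x) /\ (forall x, a1 x = x) /\
  (forall x, a2 x = x) /\ (forall x, a3 x = x).
Proof.
  intros D0 D1 D2 D3 R0 R1 R2 R3.
  assert (K : forall a ai b bi, Diff1R a ai -> Diff1R b bi -> bs a b -> incr_homeo b bi).
  { intros a ai b bi Da Db H; apply Diff1R_incr_homeo; auto.
    apply (conjugate_to_square_incr a ai b bi 0); auto; intros x; rewrite H; ring. }
  assert (H : higman_homeos a0 a1 a2 a3 b0 b1 b2 b3).
  { refine (conj _ (conj _ (conj _ (conj _ _)))); auto;
      [apply (K a3 b3) | apply (K a0 b0) | apply (K a1 b1) | apply (K a2 b2)]; auto. }
  assert (H1 := higman_rotate _ _ _ _ _ _ _ _ H).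
  assert (H2 := higman_rotate _ _ _ _ _ _ _ _ H1).
  assert (H3 := higman_rotate _ _ _ _ _ _ _ _ H2).
  repeat split.
  - apply (higman_line_incr _ _ _ _ _ _ _ _ H3); auto.
  - apply (higman_line_incr _ _ _ _ _ _ _ _ H); auto.
  - apply (higman_line_incr _ _ _ _ _ _ _ _ H1); auto.
  - apply (higman_line_incr _ _ _ _ _ _ _ _ H2); auto.
Qed.

(** * Higman's group on the circle *)

Lemma C1_comp (f g : R -> R) : Defs.C1 f -> Defs.C1 g -> Defs.C1 (fun x => f (g x)).
Proof.
  intros Cf Cg x; split.
  - apply ex_derive_comp; [apply Cf | apply Cg].
  - apply continuous_ext with (fun y => Derive g y * Derive f (g y)).
    { intros y; symmetry; apply Derive_comp; [apply Cf | apply Cg]. }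
    refine (continuous_mult (Derive g) (fun y => Derive f (g y)) x (proj2 (Cg x)) _).
    refine (continuous_comp g (Derive f) x _ (proj2 (Cf (g x)))).
    now apply C1_continuous.
Qed.

Lemma C1_translation (k : R) : Defs.C1 (fun x => x + k).
Proof.
  intros x; split; [auto_derive; auto |].
  apply continuous_ext with (fun _ => 1); [| apply continuous_const].
  intros y; symmetry; apply is_derive_unique; auto_derive; auto; ring.
Qed.

Lemma Diff1R_translate (f g : R -> R) (k : R) :
  Diff1R f g -> Diff1R (fun x => f x + k) (fun x => g (x + - k)).
Proof.
  intros (Cf & Cg & Hgf & Hfg); repeat apply conj.
  - exact (C1_comp _ _ (C1_translation k) Cf).
  - exact (C1_comp _ _ Cg (C1_translation (- k))).
  - intros x; replace (f x + k + - k) with (f x) by ring; auto.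
  - intros x; rewrite Hfg; ring.
Qed.

Lemma degree_one_translate (f : R -> R) (k : Z) (x : R) :
  (forall x, f (x + 1) = f x + 1) -> f (x + IZR k) = f x + IZR k.
Proof.
  intros H; revert x; induction k as [| k IH | k IH] using Z.peano_ind; intros x.
  - now rewrite !Rplus_0_r.
  - rewrite succ_IZR, <- Rplus_assoc, H, IH; ring.
  - unfold Z.pred; rewrite plus_IZR.
    rewrite <- (Rplus_assoc (f x)), <- IH.
    replace (x + IZR k) with (x + (IZR k + IZR (-1)) + 1) by (simpl; ring).
    rewrite H; simpl; ring.
Qed.

Lemma circle_relation (a ai b bi : R -> R) :
  CircleDiff1Lift a ai -> higman_rel_S1 a ai b ->
  exists k : Z, forall x, a (b x) = b (b (a x)) + IZR k.
Proof.
  intros [(_ & _ & E & _) _] [k H]; exists k; intros x.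
  rewrite <- H, E; reflexivity.
Qed.

(** A lift of degree -1 has [b 1 < b 0], while the relation forces [b] to be increasing. *)
Lemma circle_degree_one (a ai b bi : R -> R) (k : Z) :
  CircleDiff1Lift a ai -> CircleDiff1Lift b bi ->
  (forall x, a (b x) = b (b (a x)) + IZR k) -> forall x, b (x + 1) = b x + 1.
Proof.
  intros [Da _] [Db [H | H]] R; auto; exfalso.
  assert (Hb := conjugate_to_square_incr a ai b bi (IZR k) Da Db R).
  assert (L : b 0 < b (0 + 1)) by (apply Hb; lra).
  rewrite H in L; lra.
Qed.

(* Integer translations are central among the lifts of degree one, so replacing
   [b] by [b + k] multiplies the relation's left side by one copy of the
   translation [k] and its right side by two. *)
Lemma bs_translate (a b : R -> R) (j k : Z) :
  (forall x, a (x + 1) = a x + 1) -> (forall x, b (x + 1) = b x + 1) ->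
  (forall x, a (b x) = b (b (a x)) + IZR k) ->
  bs (fun x => a x + IZR j) (fun x => b x + IZR k).
Proof.
  intros Ha Hb H x.
  rewrite !(degree_one_translate a), !(degree_one_translate b), H by auto; ring.
Qed.

Theorem theoremB :
  (forall (a0 a1 a2 a3 b0 b1 b2 b3 : R -> R),
      Diff1R a0 b0 -> Diff1R a1 b1 -> Diff1R a2 b2 -> Diff1R a3 b3 ->
      higman_rel_R a0 b0 a1 -> higman_rel_R a1 b1 a2 ->
      higman_rel_R a2 b2 a3 -> higman_rel_R a3 b3 a0 ->
      (forall x, a0 x = x) /\ (forall x, a1 x = x) /\
      (forall x, a2 x = x) /\ (forall x, a3 x = x))
  /\
  (forall (a0 a1 a2 a3 b0 b1 b2 b3 : R -> R),
      CircleDiff1Lift a0 b0 -> CircleDiff1Lift a1 b1 ->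
      CircleDiff1Lift a2 b2 -> CircleDiff1Lift a3 b3 ->
      higman_rel_S1 a0 b0 a1 -> higman_rel_S1 a1 b1 a2 ->
      higman_rel_S1 a2 b2 a3 -> higman_rel_S1 a3 b3 a0 ->
      circ_eq a0 (fun x => x) /\ circ_eq a1 (fun x => x) /\
      circ_eq a2 (fun x => x) /\ circ_eq a3 (fun x => x)).
Proof.
  split.
  - intros a0 a1 a2 a3 b0 b1 b2 b3 D0 D1 D2 D3 R0 R1 R2 R3.
    assert (K : forall a ai b, Diff1R a ai -> higman_rel_R a ai b -> bs a b).
    { intros a ai b (_ & _ & E & _) H x; now rewrite <- H, E. }
    apply (higman_line a0 a1 a2 a3 b0 b1 b2 b3); eauto.
  - intros a0 a1 a2 a3 b0 b1 b2 b3 D0 D1 D2 D3 R0 R1 R2 R3.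
    (* Each integer is indexed by the generator that it corrects: the defect of the relation between
       [a0] and [a1] is absorbed by translating [a1], whatever the translation of [a0]. *)
    apply circle_relation in R0 as [k1 R0]; auto.
    apply circle_relation in R1 as [k2 R1]; auto.
    apply circle_relation in R2 as [k3 R2]; auto.
    apply circle_relation in R3 as [k0 R3]; auto.
    assert (T1 := circle_degree_one _ _ _ _ _ D0 D1 R0).
    assert (T2 := circle_degree_one _ _ _ _ _ D1 D2 R1).
    assert (T3 := circle_degree_one _ _ _ _ _ D2 D3 R2).
    assert (T0 := circle_degree_one _ _ _ _ _ D3 D0 R3).
    assert (L : forall f k, (forall x, f x + IZR k = x) -> circ_eq f (fun x => x)).
    { intros f k H; exists (- k)%Z; intros x.
      rewrite opp_IZR; specialize (H x); lra. }
    destruct (higman_line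
      (fun x => a0 x + IZR k0) (fun x => a1 x + IZR k1)
      (fun x => a2 x + IZR k2) (fun x => a3 x + IZR k3)
      (fun x => b0 (x + - IZR k0)) (fun x => b1 (x + - IZR k1))
      (fun x => b2 (x + - IZR k2)) (fun x => b3 (x + - IZR k3)))
      as (E0 & E1 & E2 & E3);
      try apply bs_translate; auto; try (apply Diff1R_translate; apply D0 || apply D1 || apply D2 || apply D3).
    eauto 10.
Qed.
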